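(* Suppose that the following property holds: for any continuous functions $f_n \colon C^\omega \to C$, $n \in \omega$, there exist an infinite set $N = \{ n_i \colon i \in \omega \} \subseteq \omega$ and non-empty perfect sets $P_k \subseteq C$ for $k \in \omega$ such that the subsequence $(f_{n_i})_{i \in \omega}$ is pointwise convergent on the product $\prod_{k \in \omega} P_k$. Then the answer to the Harrington problem is positive, that is: for any continuous functions $f_n \colon \mathbb{R}^\omega \to [0,1]$, $n \in \omega$, there exist an infinite set $N = \{ n_i \colon i \in \omega \} \subseteq \omega$ and non-empty perfect sets $P_j \subseteq [0,1]$ for $j \in \omega$ such that the subsequence $(f_{n_i})_{i \in \omega}$ is pointwise convergent on the product $\prod_{j \in \omega} P_j$.
   Context: $\omega$ denotes the set of natural numbers (including $0$). $C \subseteq \mathbb{R}$ is the standard Cantor set, identified with $2^\omega = \{0,1\}^\omega$ with the product topology; $C^\omega$ and $\mathbb{R}^\omega$ carry the product topology. A subset of a topological space is called perfect if it is compact and has no isolated points. An infinite set $N = \{n_i \colon i \in \omega\}\subseteq\omega$ is enumerated increasingly. *)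

(* Defs.v *)
From mathcomp Require Import all_boot all_order all_algebra.
From mathcomp Require Import all_classical all_reals all_analysis.

Set Implicit Arguments.
Unset Strict Implicit.
Unset Printing Implicit Defensive.

Import Order.TTheory GRing.Theory Num.Theory.
Import numFieldNormedType.Exports.

Local Open Scope classical_set_scope.

(* Differs from the library's [perfect_set], which asks for closed rather than
   compact sets. *)
Definition perfect (T : topologicalType) (A : set T) : Prop :=
  compact A /\ isolated A = set0.

Definition set_product (T : Type) (P : nat -> set T) : set (nat -> T) :=
  [set x | forall k, P k (x k)].

(* [n] is the increasing enumeration n_0 < n_1 < ... of [N]. *)
Definition increasing_enumeration (N : set nat) (n : nat -> nat) : Prop :=
  (forall i j : nat, (i < j)%N -> (n i < n j)%N) /\ range n = N.

Definition pointwise_convergent_on (X : Type) (Y : topologicalType)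
    (A : set X) (g : nat -> X -> Y) : Prop :=
  exists h : X -> Y, forall x, A x -> g i x @[i --> \oo] --> h x.

(* Main.v *)
(** The given functions are first pulled back to [C^omega] along a coordinatewise
    embedding [C -> [0,1]], giving continuous [F_n : C^omega -> [0,1]].  By
    compactness, [F_n] is uniformly within [1/(n+1)] of [F_n \o T] for a
    truncation [T] that remembers only finitely many bits of its argument.
    Fix an enumeration [q_j] of the rationals.  Since [T] is locally constant,
    [x |-> (j |-> q_j < F_n (T x))] is a continuous map [C^omega -> C], although
    [F_n] itself need not lift to [C].  If all these comparison bits converge
    along a subsequence, then so do the reals [F_n (T x)], hence the [F_n x]. *)

Require Import Defs.
From mathcomp Require Import all_boot all_order all_algebra.
From mathcomp Require Import all_classical all_reals all_analysis.
From mathcomp Require Import lra.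
Import Order.TTheory GRing.Theory Num.Theory.
Import numFieldNormedType.Exports.
Local Open Scope classical_set_scope.
Local Open Scope ring_scope.

Section CantorEmbedding.
Context {R : realType}.
Implicit Types (b c : cantor_space) (m n : nat).

Definition ternary_sum b n : R := \sum_(i < n) (b i)%:R * 2 * 3 ^- i.+1.

(** The standard map onto the middle-thirds set: partial sums with ternary digits 0 and 2 increase,
    so the supremum is the sum of the series. *)
Definition cantor_embedding b : R := sup (range (ternary_sum b)).

Lemma ternary_sumS b n :
  ternary_sum b n.+1 = ternary_sum b n + (b n)%:R * 2 * 3 ^- n.+1.
Proof. by rewrite /ternary_sum big_ord_recr. Qed.

Lemma ternary_sum_homo b : {homo ternary_sum b : m n / (m <= n)%N >-> m <= n}.
Proof.
apply: homo_leq => //; first exact: le_trans.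
move=> n; rewrite ternary_sumS lerDl.
by rewrite !mulr_ge0 ?invr_ge0 ?exprn_ge0.
Qed.

(** A new digit adds at most [2 * 3 ^- n.+1], exactly what the remainder bound loses in passing from
    [3 ^- n] to [3 ^- n.+1]. *)
Lemma ternary_sumD_antitone b :
  {homo (fun n => ternary_sum b n + 3 ^- n) : m n / (m <= n)%N >-> n <= m}.
Proof.
apply: homo_leq => //; first by move=> x y z xy yz; exact: le_trans yz xy.
move=> n; rewrite ternary_sumS.
have -> : 3 ^- n = 3 * 3 ^- n.+1 :> R.
  by rewrite exprS invfM mulrA divff ?mul1r.
have : 0 <= 3 ^- n.+1 :> R by rewrite invr_ge0 exprn_ge0.
by case: (b n) => /=; lra.
Qed.

Lemma ternary_sum_le b m n : ternary_sum b m <= ternary_sum b n + 3 ^- n.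
Proof.
apply: le_trans (ternary_sumD_antitone b _ _ (leq_maxr m n)).
apply: le_trans (ternary_sum_homo b _ _ (leq_maxl m n)) _.
by rewrite lerDl invr_ge0 exprn_ge0.
Qed.

Lemma cantor_embedding_itv b n :
  ternary_sum b n <= cantor_embedding b <= ternary_sum b n + 3 ^- n.
Proof.
have ub : ubound (range (ternary_sum b)) (ternary_sum b n + 3 ^- n).
  by move=> _ [m _ <-]; exact: ternary_sum_le.
apply/andP; split.
  by apply: ub_le_sup; [exists (ternary_sum b n + 3 ^- n) | exists n].
by apply: ge_sup => //; exists (ternary_sum b 0); exists 0%N.
Qed.

Lemma cantor_embedding01 b : cantor_embedding b \in `[0, 1].
Proof.
have := cantor_embedding_itv b 0.
by rewrite /ternary_sum big_ord0 add0r expr0 invr1 in_itv.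
Qed.

Lemma eq_ternary_sum b c n :
  (forall i, (i < n)%N -> b i = c i) -> ternary_sum b n = ternary_sum c n.
Proof. by move=> bc; apply: eq_bigr => i _; rewrite bc. Qed.

(** At the first differing index [n], the digit 2 gains [2 * 3 ^- n.+1], while the tail of the other
    sequence recovers at most half of that. *)
Lemma cantor_embedding_inj : injective cantor_embedding.
Proof.
suff wlt b c n : (forall i, (i < n)%N -> b i = c i) -> b n -> ~~ c n ->
    cantor_embedding c < cantor_embedding b.
  move=> b c ebc; apply/funext; elim/ltn_ind => n IH.
  case bn: (b n); case cn: (c n) => //.
    by have := wlt _ _ _ IH bn (negbT cn); rewrite ebc ltxx.
  have IH' i : (i < n)%N -> c i = b i by move/IH.
  by have := wlt _ _ _ IH' cn (negbT bn); rewrite ebc ltxx.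
move=> bc bn /negbTE cn.
have /andP[+ _] := cantor_embedding_itv b n.+1.
have /andP[_ +] := cantor_embedding_itv c n.+1.
rewrite !ternary_sumS bn cn (eq_ternary_sum _ _ _ bc) /=.
have : 0 < 3 ^- n.+1 :> R by rewrite invr_gt0 exprn_gt0.
by lra.
Qed.

Lemma near_cantor_coord b i : \forall c \near b, c i = b i.
Proof.
have := @proj_continuous nat (fun=> bool) i b [set b i].
by rewrite nbhs_principalE; apply.
Qed.

Lemma near_cantor_prefix b n :
  \forall c \near b, forall i, (i < n)%N -> c i = b i.
Proof.
have : \forall c \near b, forall i : 'I_n, (c : cantor_space) i = b i.
  apply: (@filter_forall _ _ (fun (i : 'I_n) (c : cantor_space) => c i = b i) _
    (nbhs_filter b)) => i.
  exact: near_cantor_coord.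
by apply: filterS => c cb i ilt; exact: (cb (Ordinal ilt)).
Qed.

(** Sequences with the same first [n] bits are sent into one interval of length [3 ^- n]. *)
Lemma cantor_embedding_continuous : continuous cantor_embedding.
Proof.
move=> b; apply/cvgrPdist_le => e e0.
have [n ne] : exists n, 3 ^- n <= e :> R.
  have : (3^-1 : R) ^+ n @[n --> \oo] --> 0.
    by apply: cvg_expr; rewrite ger0_norm ?invr_ge0// invf_lt1 ?ltr1n.
  move/cvgrPdist_le => /(_ e e0)[n _ /(_ n (leqnn n))/=].
  rewrite sub0r normrN exprVn ger0_norm ?invr_ge0 ?exprn_ge0//.
  by exists n.
apply: filterS (near_cantor_prefix b n) => c /eq_ternary_sum cb.
have := cantor_embedding_itv b n; have := cantor_embedding_itv c n.
by rewrite cb ler_norml; lra.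
Qed.

End CantorEmbedding.

(** By injectivity, a neighbourhood isolating [f x] in the image pulls back to one isolating [x] in
    [A]. *)
Lemma perfect_image (T U : topologicalType) (f : T -> U) (A : set T) :
  continuous f -> injective f -> perfect A -> perfect (f @` A).
Proof.
move=> fc fi [Ac Ai]; split.
  by apply: continuous_compact => //; exact: continuous_subspaceT.
apply/eqP/negPn/negP => /set0P[_ [/set_mem[x Ax <-] [V Vfx VA]]].
suff : isolated A x by rewrite Ai.
split; first exact/mem_set.
exists (f @^-1` V); first exact: fc.
apply/seteqP; split=> [y [Vfy Ay]|_ ->].
  by apply: fi; suff : (V `&` (f @` A)) (f y) by rewrite VA.
by split; [exact: (nbhs_singleton Vfx)|].
Qed.

Lemma cvg_ptwsP (I : topologicalType) (U : uniformType) (T : Type)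
    (F : set_system T) (g : T -> {ptws I -> U}) (h : {ptws I -> U}) :
  Filter F -> g @ F --> h <-> forall i, g t i @[t --> F] --> h i.
Proof. by move=> FF; exact: pointwise_cvgP. Qed.

Lemma continuous_postcomp (I : topologicalType) (T U : uniformType) (f : T -> U) :
  continuous f -> continuous (fun x : {ptws I -> T} => (f \o x : {ptws I -> U})).
Proof.
move=> fc x; apply/(@cvg_ptwsP I U _ (nbhs x)) => i /=.
apply: (@cvg_comp _ _ _ (fun y : {ptws I -> T} => y i) f) (fc _).
exact: (@proj_continuous I (fun=> T) i x).
Qed.

Section Truncation.
Local Notation X := {ptws nat -> cantor_space}.

Definition trunc (m : nat) (x : X) : X :=
  fun k i => [&& (k < m)%N, (i < m)%N & x k i].

Lemma near_coord (x : X) k i : \forall y \near x, y k i = x k i.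
Proof.
have := @proj_continuous nat (fun=> cantor_space) k x [set c | c i = x k i].
by apply; exact: near_cantor_coord.
Qed.

Lemma near_trunc (m : nat) (x : X) : \forall y \near x, trunc m y = trunc m x.
Proof.
have : \forall y \near x, forall ki : 'I_m * 'I_m, (y : X) ki.1 ki.2 = x ki.1 ki.2.
  apply: (@filter_forall _ _
    (fun (ki : 'I_m * 'I_m) (y : X) => y ki.1 ki.2 = x ki.1 ki.2) _
    (nbhs_filter x)) => ki.
  exact: near_coord.
apply: filterS => y yx; apply/funext => k; apply/funext => i; rewrite /trunc.
by case: ltnP => // km; case: ltnP => // im; rewrite (yx (Ordinal km, Ordinal im)).
Qed.

(** No continuity of [g] is assumed, since [trunc m] is locally constant; this admits the
    discontinuous comparisons with rationals. *)
Lemma continuous_trunc (Y : topologicalType) (m : nat) (g : X -> Y) :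
  continuous (g \o trunc m).
Proof.
move=> x; apply: cvg_near_cst.
by apply: filterS (near_trunc m x) => y /= ->.
Qed.

(** Convergence is joint in the point and the level, so that compactness can make it uniform. *)
Lemma cvg_trunc (x : X) : trunc p.2 p.1 @[p --> (nbhs x, \oo)] --> x.
Proof.
apply/(@cvg_ptwsP nat cantor_space) => k; apply/(@cvg_ptwsP nat bool) => i.
apply/discrete_cvg.
exists ([set y | y k i = x k i], [set m | (maxn k i < m)%N]).
  by split; [exact: near_coord | exists (maxn k i).+1].
move=> [y m] [/= yx]; rewrite gtn_max => /andP[km im].
by rewrite /trunc km im.
Qed.

(** Near each [(x, \oo)] both terms are close to [f x]; compactness, in its near-covering form, then
    yields one level [m] valid for all points. *)
Lemma trunc_approx (R : realType) (f : X -> R) (e : R) :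
  continuous f -> 0 < e -> exists m, forall x, `|f (trunc m x) - f x| < e.
Proof.
move=> fc e0.
have Xc : compact [set: X].
  have := @tychonoff _ (fun _ : nat => cantor_space) _ (fun=> cantor_space_compact).
  by congr (compact _); apply/seteqP.
have /compact_near_coveringP /(_ nat \oo) := Xc.
move=> /(_ (fun m x => `|f (trunc m x) - f x| < e)) /(_ _) H.
have [|m _ /(_ m (leqnn m)) Hm] := H _; last by exists m => x; exact: Hm.
move=> x _.
have h1 : f (trunc p.2 p.1) @[p --> (nbhs x, \oo)] --> f x.
  by apply: (cvg_comp _ f (cvg_trunc x)); exact: fc.
have h2 : f p.1 @[p --> (nbhs x, (\oo : set_system nat))] --> f x.
  by apply: (cvg_comp fst f cvg_fst); exact: fc.
have : f (trunc p.2 p.1) - f p.1 @[p --> (nbhs x, \oo)] --> (0 : R).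
  by rewrite -(subrr (f x)); exact: cvgB.
move/cvgrPdist_lt/(_ e e0).
by apply: filterS => p /=; rewrite sub0r normrN.
Qed.

End Truncation.

(** The limit is the supremum of the reals eventually below [u], that is, its limit inferior. *)
Lemma cvg_of_rat_cuts (R : realType) (u : nat -> R) :
  (forall n, u n \in `[0, 1]) ->
  (forall q : rat, cvg ((ratr q < u n) @[n --> \oo])) ->
  cvg (u @ \oo).
Proof.
move=> u01 ucut.
pose E := [set r : R | \forall n \near \oo, r < u n].
have supE : has_sup E.
  split.
    (* The inequality in [E] is strict, so 0 might not belong to [E]. *)
    exists (-1); apply: nearW => n.
    by have := u01 n; rewrite in_itv /=; lra.
  exists 1 => r [n _ /(_ n (leqnn n))/= rn].
  by have := u01 n; rewrite in_itv /=; lra.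
apply/cvg_ex; exists (sup E); apply/cvgrPdist_lt => e e0.
have [r Er rlt] := sup_adherent e0 supE.
have /rat_in_itvoo[q] : sup E < sup E + e by lra.
rewrite in_itv /= => /andP[qgt qlt].
(* A convergent bit is eventually constant; the value true would put [ratr q], which exceeds
   [sup E], into [E]. *)
have /cvg_ex[[|] /discrete_cvg cutq] := ucut q.
  have Eq : E (ratr q) by apply: filterS cutq.
  by have := sup_upper_bound supE Eq; lra.
have {}cutq : \forall n \near \oo, (ratr q < u n) = false by exact: cutq.
near=> n; have un : u n <= ratr q by rewrite leNgt (near cutq n).
have ru : r < u n by near: n; exact: Er.
by rewrite ltr_norml; lra.
Unshelve. all: by end_near.
Qed.

Theorem theorem3 (R : realType) :
  (forall f : nat -> {ptws nat -> cantor_space} -> cantor_space,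
     (forall n, continuous (f n)) ->
     exists (N : set nat) (n_ : nat -> nat) (P : nat -> set cantor_space),
       [/\ infinite_set N,
           increasing_enumeration N n_,
           forall k, P k !=set0 /\ perfect (P k) &
           pointwise_convergent_on (set_product P) (fun i => f (n_ i))]) ->
  (forall f : nat -> {ptws nat -> R} -> R,
     (forall n, continuous (f n)) ->
     (forall n x, f n x \in `[0, 1]) ->
     exists (N : set nat) (n_ : nat -> nat) (P : nat -> set R),
       [/\ infinite_set N,
           increasing_enumeration N n_,
           forall j, [/\ P j `<=` `[0, 1], P j !=set0 & perfect (P j)] &
           pointwise_convergent_on (set_product P) (fun i => f (n_ i))]).
Proof.
move=> H f fc f01.
pose e : cantor_space -> R := cantor_embedding.
pose F n (x : {ptws nat -> cantor_space}) : R := f n (e \o x).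
have Fc n : continuous (F n).
  move=> x; apply: continuous_comp (fc n _).
  exact/continuous_postcomp/cantor_embedding_continuous.
have /choice[m mP] n : exists m, forall x, `|F n (trunc m x) - F n x| < n.+1%:R^-1.
  by apply: trunc_approx.
(* The default 0 at non-codes is harmless: each rational [r] is looked up at [pickle r]. *)
pose q (j : nat) : rat := odflt 0 (unpickle j).
pose g n : {ptws nat -> cantor_space} -> cantor_space :=
  (fun y j => ratr (q j) < F n y) \o trunc (m n).
have [|N [n_ [P [Ninf Nn PP [h hP]]]]] := H g.
  by move=> n; exact: continuous_trunc.
exists N, n_, (fun j => e @` P j); split => //.
  move=> j; have [[b Pb] Pperf] := PP j; split.
  - by move=> _ [c _ <-]; exact: cantor_embedding01.
  - by exists (e b), b.
  - by apply: perfect_image => //;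
      [exact: cantor_embedding_continuous | exact: cantor_embedding_inj].
(* The limit function must be total; only its values on the product matter. *)
exists (fun y => lim (f (n_ i) y @[i --> \oo])) => y Py.
have /choice[x xP] k : exists b, P k b /\ e b = y k.
  by have [b Pb <-] := Py k; exists b.
have -> : y = e \o x by apply/funext => k; rewrite /= (xP k).2.
have gx := hP x (fun k => (xP k).1).
have Tcvg : cvg (F (n_ i) (trunc (m (n_ i)) x) @[i --> \oo]).
  apply: cvg_of_rat_cuts => [i|r]; first exact: f01.
  apply/cvg_ex; exists (h x (pickle r)).
  have /(@cvg_ptwsP nat bool)/(_ (pickle r)) := gx.
  by rewrite /g /q /= pickleK.
(* This bounds the truncation error along the subsequence by [1/(i+1)], so that it tends to 0. *)
have n_ge i : (i <= n_ i)%N.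
  elim: i => // i IH; exact: leq_ltn_trans IH (Nn.1 _ _ (ltnSn i)).
have d0 : F (n_ i) (trunc (m (n_ i)) x) - F (n_ i) x @[i --> \oo] --> 0.
  apply/norm_cvg0P; apply: squeeze_cvgr (cvg_cst 0) cvg_harmonic.
  apply: nearW => i; rewrite normr_ge0 /=.
  apply: le_trans (ltW (mP _ _)) _.
  by rewrite lef_pV2 ?posrE ?ltr0n // ler_nat ltnS.
have /cvg_ex[l Tl] := Tcvg.
suff Fl : F (n_ i) x @[i --> \oo] --> l - 0 by exact: (cvgP _ Fl).
rewrite (_ : (fun i => F (n_ i) x) = fun i =>
    F (n_ i) (trunc (m (n_ i)) x) - (F (n_ i) (trunc (m (n_ i)) x) - F (n_ i) x)).
  exact: cvgB.
by apply/funext => i; rewrite opprB addrC subrK.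
Qed.
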